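(* Let $\alpha\in(0,1]$. Assume that $n_0$ is an even positive integer such that the polynomial $p_{n_0}$ has a positive root, with smallest positive root $r_{n_0}$, and that $$\frac{\Gamma(2n_0+6)}{\Gamma(2n_0+5-\alpha)}\ge r_{n_0},\qquad \frac{n_0+1}{n_0+2}\cdot\frac{\Gamma(2n_0+6)}{\Gamma(2n_0+5-\alpha)}\ge r_{n_0},$$ and $p_{n_0}'(x)\le 0$ for all $x\in[r_{n_0+1},r_{n_0}]$. Then: (i) for every integer $n\ge n_0$ (even or odd), $p_n$ has a first (smallest) positive root $r_n$; (ii) $\lim_{n\to\infty}(r_{n+1}-r_n)=0$; (iii) for every $\varepsilon>0$ there is an integer $\tilde n\ge n_0$ with $|r_{\tilde n}-r_{\tilde n+1}|<\varepsilon$, and for any such $\tilde n$ one has $|s_{\mathbf 0}-r_{\tilde n}|<\varepsilon$, where $s_{\mathbf 0}$ is the first positive root of $p_\infty$.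
   Context: For $\alpha\in(0,1]$ let $a_0:=1$ and $a_k:=\prod_{i=1}^{k}\frac{\Gamma(2i+1-\alpha)}{\Gamma(2i+2)}$ for $k\ge 1$, where $\Gamma$ is the Euler gamma function. For $n\in\mathbb{N}\cup\{\infty\}$ let $p_n(x)=\sum_{k=0}^{n}(-1)^k a_k x^k$, $x\in\mathbb{R}$ (for $n=\infty$ the power series converges absolutely on $\mathbb{R}$). For finite $n$, $r_n$ denotes the smallest positive root of $p_n$, whenever $p_n$ has a positive root; for odd $n$ a positive root always exists, and under the stated hypotheses $r_{n_0+1}<r_{n_0}$. Under the stated hypotheses $p_\infty$ has a smallest positive root, denoted $s_{\mathbf 0}$. *)

(* Defs.v *)
From HB Require Import structures.
From mathcomp Require Import all_boot all_order all_algebra.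
From mathcomp Require Import all_classical all_reals all_analysis.
Set Implicit Arguments.
Unset Strict Implicit.
Unset Printing Implicit Defensive.
Import Order.TTheory GRing.Theory Num.Theory.
Import numFieldNormedType.Exports.
Local Open Scope classical_set_scope.
Local Open Scope ring_scope.

(* The Euler integral; meaningful for 0 < z only. *)
Definition Gamma (R : realType) (z : R) : R :=
  \int[lebesgue_measure]_(t in `]0, +oo[) (t `^ (z - 1) * expR (- t)).

Definition a (R : realType) (alpha : R) (k : nat) : R :=
  \prod_(1 <= i < k.+1)
    (Gamma ((2 * i + 1)%:R - alpha) / Gamma (2 * i + 2)%:R).

Definition p (R : realType) (alpha : R) (n : nat) : {poly R} :=
  \poly_(k < n.+1) ((-1) ^+ k * a alpha k).

Definition p_infty (R : realType) (alpha x : R) : R :=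
  limn (series (fun k => (-1) ^+ k * a alpha k * x ^+ k)).

Definition is_first_pos_root (R : realType) (f : R -> R) (x : R) : Prop :=
  [/\ 0 < x, f x = 0 & forall y, 0 < y -> f y = 0 -> x <= y].

(* [r alpha n] is the smallest positive root of [p alpha n] when there is one,
   and the junk value 0 otherwise. *)
Definition r (R : realType) (alpha : R) (n : nat) : R :=
  xget 0 [set x | is_first_pos_root (horner (p alpha n)) x].

(* Main.v *)
(* Write q_k = a_{k+1} / a_k. The functional equation of Gamma gives
   (2k+5) q_{k+1} <= (2k+3) q_k, so q decreases, q_k = O(1/k), and a_k x^k is
   dominated by the terms of an exponential series. For even n >= n0 and x in
   [0, r_{n0}] the hypothesis on r_{n0} yields (n+2) q_{n+1} x <= n+1, so that
   p_{n+2} - p_n = - x^{n+1} (a_{n+1} - a_{n+2} x) is nonpositive and strictly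
   decreasing there. Hence the first roots of even index decrease, those of odd
   index increase, and all p_n with n >= n0 are nonincreasing on
   [r_{n0+1}, r_{n0}]. Were there x < y with r_{odd} <= x and y <= r_{even}
   throughout, the positive drop g(x) - g(y) of g = p_{n0+2} would be at most
   p_n(r_{n+1}) - p_n(r_n) = a_{n+1} r_{n+1}^{n+1} for all even n > n0, which
   tends to 0. So both families of roots have a common limit s; sandwiching
   p_infty between odd and even partial sums shows that s is its first root. *)
Require Import Defs.
From HB Require Import structures.
From mathcomp Require Import all_boot all_order all_algebra.
From mathcomp Require Import all_classical all_reals all_analysis.
From mathcomp Require Import measurable_realfun zify ring lra.
From mathcomp Require polyrcf.
Import Order.TTheory GRing.Theory Num.Theory.
Import numFieldNormedType.Exports.
Local Open Scope classical_set_scope.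
Local Open Scope ring_scope.

(** * The functional equation of Gamma *)

(** For q = t/(2s) one has q <= 1 + q <= e^q, and raising to the power s gives q^s <= e^(t/2). Half
    of the decay of e^(-t) thus absorbs the power of t, which yields integrability and the limit at
    infinity. *)
Lemma powR_le_expR_half {R : realType} (s t : R) : 0 < s -> 0 <= t ->
  t `^ s <= (2 * s) `^ s * expR (t / 2).
Proof.
move=> s0 t0; have d0 : 0 < 2 * s by rewrite mulr_gt0.
have {1}-> : t = (2 * s) * (t / (2 * s)) by field; exact: lt0r_neq0.
have q0 : 0 <= t / (2 * s) by rewrite divr_ge0// ltW.
rewrite powRM ?(ltW d0)// ler_wpM2l ?powR_ge0//.
have -> : t / 2 = t / (2 * s) * s by field; exact: lt0r_neq0.
rewrite expRM ge0_ler_powR// ?ltW// ?nnegrE ?expR_ge0//.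
by rewrite (lt_le_trans _ (expR_ge1Dx _))// ltr_pwDl.
Qed.

Lemma within_continuous_powR {R : realType} (s : R) : 0 < s ->
  {within `[0, +oo[, continuous (fun t : R => t `^ s)}.
Proof.
move=> s0; apply/continuous_within_itvcyP; split; last first.
  by rewrite powR0 ?gt_eqF//; exact: powR_cvg0.
move=> x; rewrite in_itv/= andbT => x0.
apply/differentiable_continuous/derivable1_diffP.
by apply: derivable_powR; rewrite in_itv/= x0.
Qed.

Lemma cvgy_expR_rate {R : realType} (c : R) : 0 < c ->
  expR (- (c * t)) @[t --> +oo] --> (0 : R).
Proof.
move=> c0; apply: (@cvg_comp _ _ _ (fun t => c * t) (fun t => expR (- t)) _
  (pinfty_nbhs R)); last exact: cvgr_expR.
exact: gt0_cvgMry.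
Qed.

Lemma continuous_expR_rate {R : realType} (c : R) :
  continuous (fun t : R => expR (- (c * t))).
Proof.
move=> t; apply: continuous_comp; last exact: continuous_expR.
apply: continuousN; apply: continuousM => //; exact: cst_continuous.
Qed.

Lemma integral_expR_rate {R : realType} (b c : R) : 0 < c ->
  (\int[lebesgue_measure]_(t in `[b, +oo[) (c * expR (- (c * t)))%:E =
   (expR (- (c * b)))%:E)%E.
Proof.
move=> c0; rewrite (@ge0_continuous_FTC2y _ _
  (fun t => - expR (- (c * t))) _ 0) ?sub0e ?EFinN ?oppeK ?add0e//.
- by move=> x _; rewrite mulr_ge0 ?expR_ge0 ?ltW.
- apply: continuous_subspaceT => x; apply: cvgM; first exact: cvg_cst.
  exact: continuous_expR_rate.
- by rewrite -oppr0; apply: cvgN; exact: cvgy_expR_rate.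
- by apply: cvgN; apply/cvg_at_right_filter; exact: continuous_expR_rate.
- move=> x _; rewrite derive1E deriveN; last exact: ex_derive.
  by rewrite derive_val /GRing.scale/= mulr1 mulrN opprK mulrC.
Qed.

Lemma integrable_expR_rate {R : realType} (b c K : R) : 0 < c ->
  lebesgue_measure.-integrable `[b, +oo[
    (EFin \o (fun t : R => K * expR (- (c * t)))).
Proof.
move=> c0.
have mf k : measurable_fun `[b, +oo[ (EFin \o (fun t : R => k * expR (- (c * t)))).
  apply/measurable_EFinP; apply: measurable_funTS.
  apply: continuous_measurable_fun => x.
  by apply: cvgM; [exact: cvg_cst|exact: continuous_expR_rate].
have -> : EFin \o (fun t : R => K * expR (- (c * t))) =
    (fun t => (K / c)%:E * (EFin \o (fun t => c * expR (- (c * t)))%R) t)%E.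
  by apply/funext => x; rewrite /= -EFinM mulrA divfK// gt_eqF.
apply: integrableZl => //; apply/integrableP; split; first exact: mf.
under eq_integral do
  rewrite /= ger0_norm ?mulr_ge0 ?expR_ge0 ?(ltW c0)//.
by rewrite /= integral_expR_rate// ltry.
Qed.

Lemma integrable_powR_expR {R : realType} (s : R) : 0 < s ->
  lebesgue_measure.-integrable `[0, +oo[
    (EFin \o (fun t => t `^ s * expR (- t))).
Proof.
move=> s0.
have := integrable_expR_rate 0 2^-1 ((2 * s) `^ s) (ltac:(by rewrite invr_gt0)).
apply: le_integrable => //.
  apply/measurable_EFinP/measurable_funTS; apply: measurable_funM.
    exact: measurable_powR.
  by apply: continuous_measurable_fun => x; apply: continuous_comp;
    [exact: opp_continuous|exact: continuous_expR].
move=> x /=; rewrite in_itv/= andbT => x0.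
rewrite lee_fin !ger0_norm ?mulr_ge0 ?powR_ge0 ?expR_ge0//.
have -> : - (2^-1 * x) = x / 2 - x by lra.
by rewrite expRD mulrA ler_wpM2r ?expR_ge0// powR_le_expR_half.
Qed.

Lemma integrable_itv_cy_oy {R : realType} (f : R -> R) :
  lebesgue_measure.-integrable `[0, +oo[ (EFin \o f) ->
  lebesgue_measure.-integrable `]0, +oo[ (EFin \o f).
Proof.
apply: integrableS => //; apply: subset_itvr; by rewrite bnd_simp.
Qed.

(** The point 0 is a null set. The closed half-line is the domain on which the fundamental theorem
    of calculus is applied below. *)
Lemma Gamma_itv_cy {R : realType} (s : R) : 0 < s ->
  Gamma (s + 1) =
  \int[lebesgue_measure]_(t in `[0, +oo[) (t `^ s * expR (- t)).
Proof.
move=> s0; rewrite /Gamma addrK Rintegral_itv_obnd_cbnd//.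
exact: integrable_itv_cy_oy (integrable_powR_expR _ s0).
Qed.

Lemma Gamma_gt0 {R : realType} (s : R) : 1 < s -> 0 < Gamma s.
Proof.
rewrite -subr_gt0 => s0; rewrite -(subrK 1 s) Gamma_itv_cy//.
have ips := integrable_powR_expR _ s0.
(* On [1, +oo[ the power is at least 1, so the integral is bounded below by that of e^(-t), which is
   e^(-1). *)
apply: (@lt_le_trans _ _
  (\int[lebesgue_measure]_(t in `[1, +oo[) (1 * expR (- (1 * t))))).
  by rewrite /Rintegral integral_expR_rate//= expR_gt0.
have s1 : [set` `[1 : R, +oo[] `<=` [set` `[0 : R, +oo[].
  by apply: subset_itvr; rewrite bnd_simp.
apply: (@le_trans _ _
  (\int[lebesgue_measure]_(t in `[1, +oo[) (t `^ (s - 1) * expR (- t)))).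
  apply: le_Rintegral => //.
  - exact: integrable_expR_rate.
  - by apply: integrableS ips.
  - move=> x; rewrite /= in_itv/= andbT => x1.
    rewrite !mul1r ler_peMl ?expR_ge0//.
    by rewrite (le_trans _ (ler_powR _ (ltW s0)))// powRr0.
apply: fine_le.
- apply: integrable_fin_num => //; by apply: integrableS ips.
- exact: integrable_fin_num.
- apply: ge0_subset_integral => //.
    by case/integrableP: ips.
  by move=> x _; rewrite lee_fin mulr_ge0 ?powR_ge0 ?expR_ge0.
Qed.

Lemma cvgy_powR_expR {R : realType} (s : R) : 0 < s ->
  t `^ s * expR (- t) @[t --> +oo] --> (0 : R).
Proof.
move=> s0.
apply: (@squeeze_cvgr _ _ _ _ (fun=> 0) (fun t => (2 * s) `^ s * expR (- (2^-1 * t)))).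
- near=> t; have t0 : 0 <= t by near: t; exact: nbhs_pinfty_ge.
  rewrite mulr_ge0 ?powR_ge0 ?expR_ge0//=.
  have -> : - (2^-1 * t) = t / 2 - t by lra.
  by rewrite expRD mulrA ler_wpM2r ?expR_ge0// powR_le_expR_half.
- exact: cvg_cst.
- rewrite -[X in _ --> X](mulr0 ((2 * s) `^ s)).
  apply: cvgM; first exact: cvg_cst.
  by apply: cvgy_expR_rate; rewrite invr_gt0.
Unshelve. all: by end_near. Qed.

(** Integration by parts. The bound 1 < s keeps both exponents s and s - 1 positive, so that both
    integrands are continuous up to 0. *)
Lemma Gamma_succ {R : realType} (s : R) : 1 < s ->
  Gamma (s + 1) = s * Gamma s.
Proof.
move=> s1; have s0 : 0 < s by rewrite (lt_trans _ s1).
have s10 : 0 < s - 1 by rewrite subr_gt0.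
rewrite -{3}(subrK 1 s) !Gamma_itv_cy//.
set I1 := LHS; set I2 := (X in _ = s * X).
(* The constant C makes the derivative of -(t^s + C) e^{-t} nonnegative, as
   the fundamental theorem of calculus on [0, +oo[ requires. *)
pose C := s `^ s.
have iK K : lebesgue_measure.-integrable `[0, +oo[
    (EFin \o (fun t : R => K * expR (- t))).
  have := @integrable_expR_rate _ 0 1 K ltr01.
  by rewrite (_ : (fun t => K * expR (- (1 * t))) = (fun t => K * expR (- t)))//;
    apply/funext => t; rewrite mul1r.
have i0 : lebesgue_measure.-integrable `[0, +oo[
    (EFin \o (fun t : R => expR (- t))).
  have := iK 1; rewrite (_ : (fun t => 1 * expR (- t)) = (fun t => expR (- t)))//.
  by apply/funext => t; rewrite mul1r.
have eI : \int[lebesgue_measure]_(t in `[0, +oo[) (expR (- t)) = 1 :> R.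
  have := @integral_expR_rate R 0 1 ltr01.
  rewrite mulr0 oppr0 expR0 /Rintegral => eI.
  by under eq_integral do rewrite -[expR _]mul1r -[X in - X]mul1r; rewrite eI.
have i1 := integrable_powR_expR _ s0.
have i2 := integrable_powR_expR _ s10.
have is2 : lebesgue_measure.-integrable `[0, +oo[
    (EFin \o (fun t : R => s * (t `^ (s - 1) * expR (- t)))).
  rewrite (_ : EFin \o _ = (fun t => s%:E *
    (EFin \o (fun t => t `^ (s - 1) * expR (- t))%R) t)%E)//.
  exact: integrableZl.
have i1C : lebesgue_measure.-integrable `[0, +oo[
    (EFin \o (fun t : R => t `^ s * expR (- t) + C * expR (- t))).
  rewrite (_ : EFin \o _ = (EFin \o (fun t => t `^ s * expR (- t))%R) \+
    (EFin \o (fun t => C * expR (- t))%R))%E//.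
  exact: integrableD.
have is_derive_F (x : R) : 0 < x -> is_derive x 1
    (fun t : R => - ((t `^ s + C) * expR (- t)))
    (x `^ s * expR (- x) + C * expR (- x) - s * (x `^ (s - 1) * expR (- x))).
  move=> x0; have dp := is_derive1_powR s x0.
  by apply: is_derive_eq; rewrite /GRing.scale/=; lra.
have : \int[lebesgue_measure]_(t in `[0, +oo[)
    (t `^ s * expR (- t) + C * expR (- t) - s * (t `^ (s - 1) * expR (- t))) =
    I1 + C - s * I2.
  by rewrite RintegralB ?RintegralD ?RintegralZl// eI mulr1.
(* The primitive tends to 0 at infinity and to -C at 0, so the integral is C; equating this with
   [I1 + C - s * I2] leaves [I1 = s * I2]. *)
rewrite (@Rintegral_ge0_continuous_FTC2y _ _
  (fun t => - ((t `^ s + C) * expR (- t))) _ 0).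
- by rewrite powR0 ?gt_eqF// add0r oppr0 expR0 mulr1; lra.
- move=> x x0; rewrite [X in _ - X]mulrA -mulrDl -mulrBl mulr_ge0 ?expR_ge0//.
  (* The term s x^(s-1) is at most s s^(s-1) = C when x <= s, and at most x x^(s-1) = x^s when x >=
     s. *)
  rewrite subr_ge0; have [xs|/ltW sx] := leP x s.
    apply: (@le_trans _ _ C); last by rewrite lerDr powR_ge0.
    rewrite /C -[leRHS]mulr_powRB1 ?ler_pM2l ?(ltW s0)//.
    by rewrite ge0_ler_powR ?nnegrE ?(ltW s10) ?(ltW s0).
  apply: (@le_trans _ _ (x `^ s)); last by rewrite lerDl powR_ge0.
  by rewrite -[leRHS]mulr_powRB1 ?ler_wpM2r ?powR_ge0.
- have cs := within_continuous_powR _ s0.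
  have cs1 := within_continuous_powR _ s10.
  have ce : {within `[0, +oo[, continuous (fun t : R => expR (- t))}.
    apply: continuous_subspaceT => x; apply: continuous_comp;
      [exact: opp_continuous|exact: continuous_expR].
  move=> x; apply: cvgB; first apply: cvgD.
  - by apply: cvgM; [exact: cs|exact: ce].
  - by apply: cvgM; [exact: cvg_cst|exact: ce].
  - apply: cvgM; [exact: cvg_cst|].
    by apply: cvgM; [exact: cs1|exact: ce].
- rewrite (_ : (fun t => _) =
      (fun t => - (t `^ s * expR (- t) + C * expR (- t)))); last first.
    by apply/funext => t; rewrite mulrDl.
  rewrite -[0 in X in _ --> X]oppr0 -[0 in X in _ --> X](addr0 0).
  apply: cvgN; apply: cvgD; first exact: cvgy_powR_expR.
  rewrite -[X in _ --> X](mulr0 C); apply: cvgM; first exact: cvg_cst.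
  exact: cvgr_expR.
- by move=> x x0; have [] := is_derive_F x x0.
- apply: cvgN; apply: cvgM.
    apply: cvgD; last exact: cvg_cst.
    by rewrite powR0 ?gt_eqF//; exact: powR_cvg0.
  apply/cvg_at_right_filter; apply: continuous_comp;
      [exact: opp_continuous|exact: continuous_expR].
- move=> x; rewrite in_itv/= andbT => x0.
  by have [_ dF] := is_derive_F x x0; rewrite derive1E dF.
Qed.

(** * The coefficients and their ratios *)

(** The quotient q_k = a_{k+1} / a_k, that is, the factor of index k+1 in the product [a]. *)
Definition ratio {R : realType} (alpha : R) (k : nat) : R :=
  Gamma ((2 * k + 3)%:R - alpha) / Gamma (2 * k + 4)%:R.

Lemma a_succ {R : realType} (alpha : R) (k : nat) :
  a alpha k.+1 = a alpha k * ratio alpha k.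
Proof.
have e n : (2 * k.+1 + n = 2 * k + n.+2)%N by lia.
by rewrite /a big_nat_recr; [rewrite /ratio (e 1) (e 2)|].
Qed.

Lemma ratio_gt0 {R : realType} (alpha : R) (k : nat) : alpha <= 1 ->
  0 < ratio alpha k.
Proof.
move=> a1; rewrite divr_gt0// Gamma_gt0 ?ltr1n ?addnS//.
by have := ler0n R (2 * k); rewrite -!natr1; lra.
Qed.

(** Both Gamma arguments grow by 2 with k, so the functional equation is used twice in the numerator
    and twice in the denominator. *)
Lemma ratio_succ {R : realType} (alpha : R) (k : nat) : alpha <= 1 ->
  ratio alpha k.+1 = ratio alpha k *
    (((2 * k + 4)%:R - alpha) * ((2 * k + 3)%:R - alpha) /
     ((2 * k + 5)%:R * (2 * k + 4)%:R)).
Proof.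
move=> a1; have k0 := ler0n R (2 * k).
have E (n : nat) : (2 * k + n)%:R = (2 * k)%:R + n%:R :> R by rewrite natrD.
have Ek (n : nat) : (2 * k.+1 + n)%:R = (2 * k)%:R + n%:R + 2 :> R.
  by rewrite -natrD -(natrD _ _ 2); congr _%:R; lia.
rewrite /ratio !E !Ek.
set x : R := (2 * k)%:R in k0 *.
have -> : x + 3 + 2 - alpha = (x + 3 - alpha) + 1 + 1 by lra.
have -> : x + 4 + 2 = (x + 4) + 1 + 1 by lra.
rewrite !Gamma_succ; try lra.
have G4 : Gamma (x + 4) != 0 by rewrite gt_eqF// Gamma_gt0//; lra.
move: {E Ek} x k0 (Gamma _) (Gamma _) G4 => x k0 g3 g4 G4.
by field; rewrite G4 andbT; apply/andP; split; apply: lt0r_neq0; lra.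
Qed.

(** After 2k+5 cancels, the remaining factor is (2k+4-alpha)/(2k+4) <= 1 times 2k+3-alpha <=
    2k+3. *)
Lemma ratio_succ_le {R : realType} (alpha : R) (k : nat) :
  0 < alpha -> alpha <= 1 ->
  (2 * k + 5)%:R * ratio alpha k.+1 <= (2 * k + 3)%:R * ratio alpha k.
Proof.
move=> a0 a1; rewrite ratio_succ// mulrCA [leRHS]mulrC ler_pM2l ?ratio_gt0//.
rewrite !natrD; set x : R := (2 * k)%:R.
have k0 : 0 <= x by rewrite ler0n.
rewrite [leLHS](_ : _ = (x + 4 - alpha) / (x + 4) * (x + 3 - alpha)); last first.
  by field; apply/andP; split; apply: lt0r_neq0; lra.
apply: (@le_trans _ _ (1 * (x + 3 - alpha))); last by lra.
rewrite ler_wpM2r ?ler_pdivrMr; lra.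
Qed.

Lemma ratio_noninc {R : realType} (alpha : R) (k : nat) :
  0 < alpha -> alpha <= 1 -> ratio alpha k.+1 <= ratio alpha k.
Proof.
move=> a0 a1; have h := ratio_succ_le alpha k a0 a1.
have k3 : 0 < (2 * k + 3)%:R :> R by rewrite ltr0n addnS.
rewrite -(ler_pM2l k3); apply: le_trans h.
by rewrite ler_pM2r ?ratio_gt0// ler_nat; lia.
Qed.

(** The sequence (2k+3) q_k is nonincreasing with first term 3 q_0, and k+1 <= 2k+3. *)
Lemma ratio_le {R : realType} (alpha : R) (k : nat) :
  0 < alpha -> alpha <= 1 -> ratio alpha k <= 3 * ratio alpha 0 / k.+1%:R.
Proof.
move=> a0 a1; rewrite ler_pdivlMr ?ltr0n// mulrC.
apply: (@le_trans _ _ ((2 * k + 3)%:R * ratio alpha k)).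
  by rewrite ler_pM2r ?ratio_gt0// ler_nat; lia.
elim: k => [|k IH]; first by rewrite muln0.
apply: le_trans IH; rewrite (_ : 2 * k.+1 + 3 = 2 * k + 5)%N; last by lia.
exact: ratio_succ_le.
Qed.

Lemma a_gt0 {R : realType} (alpha : R) (k : nat) : alpha <= 1 -> 0 < a alpha k.
Proof.
move=> a1; elim: k => [|k IH]; first by rewrite /a big_geq.
by rewrite a_succ mulr_gt0// ratio_gt0.
Qed.

(** Multiplying the bounds q_i <= 3 q_0 / (i+1) over i < k produces the factorial. *)
Lemma a_le_exp_coeff {R : realType} (alpha : R) (k : nat) :
  0 < alpha -> alpha <= 1 -> a alpha k <= exp_coeff (3 * ratio alpha 0) k.
Proof.
move=> a0 a1; rewrite /exp_coeff/=; elim: k => [|k IH].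
  by rewrite /a big_geq// expr0 fact0 divr1.
rewrite a_succ exprSr factS natrM invfM mulrACA [leRHS]mulrAC.
rewrite [leRHS](_ : _ =
    (3 * ratio alpha 0) ^+ k / k`!%:R * (3 * ratio alpha 0 / k.+1%:R)).
  apply: ler_pM IH _; last exact: ratio_le.
    by rewrite ltW ?a_gt0.
  by rewrite ltW ?ratio_gt0.
by ring.
Qed.

Lemma is_cvg_series_p_infty {R : realType} (alpha x : R) :
  0 < alpha -> alpha <= 1 ->
  cvgn (series (fun k => (-1) ^+ k * a alpha k * x ^+ k)).
Proof.
move=> a0 a1; apply: normed_cvg.
apply: (@series_le_cvg _ _ (exp_coeff (3 * ratio alpha 0 * `|x|))).
- by move=> k /=.
- move=> k; apply: exp_coeff_ge0; apply: mulr_ge0 => //.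
  by apply: mulr_ge0 => //; apply/ltW/ratio_gt0.
- move=> k /=; rewrite !normrM normrX normrN1 expr1n mul1r normrX.
  rewrite (ger0_norm (ltW (a_gt0 _ _ a1))) /exp_coeff/= exprMn mulrAC.
  by rewrite ler_wpM2r ?exprn_ge0// a_le_exp_coeff.
- exact: is_cvg_series_exp_coeff.
Qed.

(** * Partial sums and first positive roots *)

(** For x > 0 the inequality says that the derivative a_{n+1} x^n ((n+1) - (n+2) q_{n+1} x) of
    x^{n+1} (a_{n+1} - a_{n+2} x) is nonnegative. *)
Definition small {R : realType} (alpha : R) (n : nat) (x : R) : Prop :=
  0 <= x /\ n.+2%:R * (ratio alpha n.+1 * x) <= n.+1%:R.

(** Induction on the index: (i+2) q_{i+1} y <= i+1 forces q_{i+1} y <= 1, and since q decreases,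
    (i+3) q_{i+2} y <= (i+2) q_{i+1} y + q_{i+1} y <= i+2. *)
Lemma small_le {R : realType} (alpha : R) (m n : nat) (x y : R) :
  0 < alpha -> alpha <= 1 -> small alpha m x -> (m <= n)%N -> 0 <= y <= x ->
  small alpha n y.
Proof.
move=> a0 a1 [x0 sx] /subnK <- /andP[y0 yx]; split=> //.
elim: (n - m)%N => [|j IH].
  by apply: le_trans sx; rewrite ler_pM2l ?ltr0n// ler_pM2l ?ratio_gt0.
rewrite addSn; set i := (j + m)%N in IH *.
have q0 : 0 <= ratio alpha i.+1 * y by rewrite mulr_ge0// ltW ?ratio_gt0.
have h : ratio alpha i.+2 * y <= ratio alpha i.+1 * y.
  by apply: ler_wpM2r; [|exact: ratio_noninc].
apply: (@le_trans _ _ (i.+3%:R * (ratio alpha i.+1 * y))).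
  by rewrite ler_pM2l ?ltr0n.
have u1 : ratio alpha i.+1 * y <= 1.
  by rewrite -(ler_pM2l (ltr0Sn R i.+1)) mulr1 (le_trans IH)// ler_nat.
rewrite -[i.+3%:R]natr1 mulrDl mul1r.
by apply: le_trans (lerD IH u1) _; rewrite natr1.
Qed.

Lemma small_lt1 {R : realType} (alpha : R) (n : nat) (x : R) :
  small alpha n x -> ratio alpha n.+1 * x < 1.
Proof.
move=> [x0 sx]; rewrite -(ltr_pM2l (ltr0Sn R n.+1)) mulr1.
by rewrite (le_lt_trans sx)// ltr_nat.
Qed.

Lemma p_succ {R : realType} (alpha : R) (n : nat) :
  p alpha n.+1 = p alpha n + ((-1) ^+ n.+1 * a alpha n.+1) *: 'X^(n.+1).
Proof. by rewrite /p !poly_def big_ord_recr. Qed.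

Lemma p_horner_succ {R : realType} (alpha : R) (n : nat) (x : R) :
  (p alpha n.+1).[x] =
  (p alpha n).[x] + (-1) ^+ n.+1 * (a alpha n.+1 * x ^+ n.+1).
Proof. by rewrite p_succ hornerD hornerZ hornerXn mulrA. Qed.

Lemma p_horner0 {R : realType} (alpha : R) (n : nat) : (p alpha n).[0] = 1.
Proof.
elim: n => [|n IH]; last by rewrite p_horner_succ IH expr0n/= !mulr0 addr0.
by rewrite horner_coef0 coef_poly/= expr0 mul1r /a big_geq.
Qed.

Lemma p_horner_succ2 {R : realType} (alpha : R) (n : nat) (x : R) :
  (p alpha n.+2).[x] = (p alpha n).[x] -
  (-1) ^+ n * (a alpha n.+1 * x ^+ n.+1 * (1 - ratio alpha n.+1 * x)).
Proof.
by rewrite !p_horner_succ (a_succ _ n.+1) !(exprS (-1)) (exprS x n.+1); ring.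
Qed.

Lemma a_expr_gt0 {R : realType} (alpha : R) (n : nat) (x : R) :
  alpha <= 1 -> 0 < x -> 0 < a alpha n * x ^+ n.
Proof. by move=> a1 x0; rewrite mulr_gt0 ?a_gt0// exprn_gt0. Qed.

Lemma p_even_succ_lt {R : realType} (alpha : R) (n : nat) (x : R) :
  alpha <= 1 -> ~~ odd n -> 0 < x -> (p alpha n.+1).[x] < (p alpha n).[x].
Proof.
move=> a1 /negbTE ev x0; rewrite p_horner_succ -signr_odd/= ev expr1.
by rewrite mulN1r gtrDl oppr_lt0 a_expr_gt0.
Qed.

Lemma p_even_succ2_le {R : realType} (alpha : R) (n : nat) (x : R) :
  alpha <= 1 -> ~~ odd n -> small alpha n x ->
  (p alpha n.+2).[x] <= (p alpha n).[x].
Proof.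
move=> a1 /negbTE ev sx; rewrite p_horner_succ2 -signr_odd ev expr0 mul1r.
have [x0 _] := sx; have x1 := small_lt1 _ _ _ sx.
rewrite gerBl mulr_ge0 ?subr_ge0 ?(ltW x1)// mulr_ge0 ?exprn_ge0//.
exact/ltW/a_gt0.
Qed.

Lemma p_odd_succ2_ge {R : realType} (alpha : R) (n : nat) (x : R) :
  alpha <= 1 -> odd n -> small alpha n x ->
  (p alpha n).[x] <= (p alpha n.+2).[x].
Proof.
move=> a1 od sx; rewrite p_horner_succ2 -signr_odd od expr1 mulN1r opprK.
have [x0 _] := sx; have x1 := small_lt1 _ _ _ sx.
rewrite lerDl mulr_ge0 ?subr_ge0 ?(ltW x1)// mulr_ge0 ?exprn_ge0//.
exact/ltW/a_gt0.
Qed.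

(** The mean value theorem for [d], the difference of the two polynomials, reduces the claim to a
    negative derivative at an interior point c. *)
Lemma p_even_increment_lt {R : realType} (alpha : R) (n : nat) (x y : R) :
  0 < alpha -> alpha <= 1 -> ~~ odd n -> small alpha n y -> 0 <= x < y ->
  (p alpha n.+2).[y] - (p alpha n.+2).[x] < (p alpha n).[y] - (p alpha n).[x].
Proof.
move=> a0 a1 /negbTE ev [y0 sy] /andP[x0 xy].
pose d := p alpha n.+2 - p alpha n.
have dE : d = a alpha n.+2 *: 'X^(n.+2) - a alpha n.+1 *: 'X^(n.+1).
  rewrite /d !p_succ -!(signr_odd _ _.+1)/= ev/= expr0 expr1 mul1r mulN1r scaleNr.
  by ring.
have [c] := @polyrcf.poly_mvt _ _ _ d xy; rewrite in_itv/= => /andP[xc cy].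
rewrite !hornerE /= -/d => E.
have c0 : 0 < c by rewrite (le_lt_trans x0).
suff dc : d^`().[c] < 0.
  have : d^`().[c] * (y - x) < 0 by rewrite nmulr_rlt0 ?subr_gt0.
  by rewrite -E; lra.
(* Strictness comes from c < y, even when [small] is an equality at y. *)
have {}sy : n.+2%:R * (ratio alpha n.+1 * c) < n.+1%:R.
  by apply: lt_le_trans sy; rewrite !ltr_pM2l ?ltr0n ?ratio_gt0.
have dXn k : ('X^(k.+1) : {poly R})^`().[c] = k.+1%:R * c ^+ k.
  by rewrite derivXn hornerMn hornerXn mulr_natl.
rewrite dE derivB !derivZ hornerD hornerN !hornerZ !dXn (a_succ _ n.+1) exprS.
have h : a alpha n.+1 * c ^+ n *
    (n.+2%:R * (ratio alpha n.+1 * c) - n.+1%:R) < 0.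
  by rewrite pmulr_rlt0 ?subr_lt0// mulr_gt0 ?a_gt0// exprn_gt0.
by apply: le_lt_trans h; rewrite le_eqVlt; apply/orP; left; apply/eqP; ring.
Qed.

(** * Existence and comparison of first positive roots of polynomials *)

Lemma first_pos_root_exists {R : realType} (f : {poly R}) (b : R) :
  0 < f.[0] -> 0 < b -> f.[b] <= 0 ->
  exists x, is_first_pos_root (horner f) x.
Proof.
move=> f0 b0 fb.
have fn0 : f != 0 by apply: contraTneq f0 => ->; rewrite horner0 -leNgt.
have [x /[!in_itv]/= /andP[x0 xb] /rootP fx] :
    {x | x \in `[0, b] & root f x}.
  by apply: polyrcf.poly_ivt; [exact: ltW|rewrite pmulr_rle0].
have {}x0 : 0 < x.
  by rewrite lt_def x0 andbT; apply: contraTneq f0 => <-; rewrite fx -leNgt.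
(* The first root in ]0, x[ is taken if there is one; otherwise the root x itself is the first. *)
case: (polyrcf.next_rootP f 0 x) => [f00|y _ fy|c _ _].
- by rewrite f00 eqxx in fn0.
- rewrite in_itv/= => /andP[y0 yx] noroot; exists y; split=> // z z0 fz.
  rewrite leNgt; apply/negP => zy; have := noroot z.
  by rewrite in_itv/= z0 zy rootE fz eqxx => /(_ isT).
- move=> noroot; exists x; split=> // z z0 fz.
  rewrite leNgt; apply/negP => zy; have := noroot z.
  by rewrite in_itv/= z0 zy rootE fz eqxx => /(_ isT).
Qed.

Lemma first_pos_root_le {R : realType} (f : {poly R}) (x b : R) :
  is_first_pos_root (horner f) x -> 0 < f.[0] -> 0 < b -> f.[b] <= 0 -> x <= b.
Proof.
move=> [_ _ xmin] f0 b0 fb.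
have [y /[!in_itv]/= /andP[y0 yb] /rootP fy] :
    {x | x \in `[0, b] & root f x}.
  by apply: polyrcf.poly_ivt; [exact: ltW|rewrite pmulr_rle0].
apply: le_trans yb; apply: xmin => //.
by rewrite lt_def y0 andbT; apply: contraTneq f0 => <-; rewrite fy -leNgt.
Qed.

Lemma r_first_pos_root {R : realType} (alpha : R) (n : nat) (b : R) :
  0 < b -> (p alpha n).[b] <= 0 ->
  is_first_pos_root (horner (p alpha n)) (r alpha n).
Proof.
move=> b0 pb; apply: xgetPex.
by apply: first_pos_root_exists b0 pb; rewrite p_horner0.
Qed.

(** The tool for comparing first roots: p_n equals 1 at 0, so it vanishes no later than at any
    positive point where it is nonpositive. *)
Lemma r_le {R : realType} (alpha : R) (n : nat) (b : R) :
  0 < b -> (p alpha n).[b] <= 0 -> r alpha n <= b.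
Proof.
move=> b0 pb; apply: first_pos_root_le (r_first_pos_root _ _ _ b0 pb) _ b0 pb.
by rewrite p_horner0.
Qed.

(** * Nested roots *)

(** The data from which the roots of all later indices are controlled. The root condition excludes
    the default value of [r]. *)
Definition nested_start {R : realType} (alpha : R) (m : nat) : Prop :=
  [/\ 0 < alpha, alpha <= 1, ~~ odd m,
      is_first_pos_root (horner (p alpha m)) (r alpha m)
    & small alpha m (r alpha m)].

Lemma even_double_add (k m : nat) : ~~ odd m -> ~~ odd (k.*2 + m).
Proof. by rewrite oddD odd_double. Qed.

Lemma double_add_cover (m n : nat) : (m <= n)%N ->
  exists k, n = (k.*2 + m)%N \/ n = (k.*2 + m).+1.
Proof.
move=> mn; exists (n - m)./2; have := odd_double_half (n - m).
by case: (odd _) => /=; lia.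
Qed.

Lemma cvg_subseq_ge {R : realType} (u : nat -> R) (h : nat -> nat) (l : R) :
  (forall k, (k <= h k)%N) -> u @ \oo --> l -> (u \o h) @ \oo --> l.
Proof.
move=> hk ul; apply: cvg_comp ul => A [N _ NA]; exists N => // k /= Nk.
by apply: NA => /=; exact: leq_trans (hk k).
Qed.

(* The terms are those of the series p_infty at -x. *)
Lemma cvg_a_expr {R : realType} (alpha x : R) : 0 < alpha -> alpha <= 1 ->
  (fun k => a alpha k * x ^+ k) @ \oo --> (0 : R).
Proof.
move=> a0 a1; have := cvg_series_cvg_0 (is_cvg_series_p_infty alpha (- x) a0 a1).
rewrite (_ : (fun k => _) = (fun k => a alpha k * x ^+ k))//.
apply/funext => k; rewrite (exprNn x) mulrACA -exprD addnn -signr_odd.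
by rewrite odd_double expr0 mul1r.
Qed.

(** The terms a_k b^k tend to 0, also along the indices [h k], since these tend to infinity. *)
Lemma le0_of_le_a_expr {R : realType} (alpha b c : R) (h : nat -> nat) :
  0 < alpha -> alpha <= 1 -> (forall k, (k <= h k)%N) ->
  (forall k, c <= a alpha (h k) * b ^+ h k) -> c <= 0.
Proof.
move=> a0 a1 hk ch; have cv := cvg_subseq_ge _ _ _ hk (cvg_a_expr _ b a0 a1).
rewrite -(cvg_lim _ cv)//; apply: limr_ge; first by apply/cvg_ex; exists 0.
by apply: nearW.
Qed.

Lemma cvg_p_infty {R : realType} (alpha x : R) : 0 < alpha -> alpha <= 1 ->
  (fun n => (p alpha n).[x]) @ \oo --> p_infty alpha x.
Proof.
move=> a0 a1; have := is_cvg_series_p_infty alpha x a0 a1.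
(* The shift is needed because [series] at n has n terms, whereas [p alpha n] has n+1. *)
rewrite -cvg_shiftS -/(p_infty alpha x).
rewrite [X in X @ _ --> _ -> _](_ : _ = (fun n => (p alpha n).[x]))//.
apply/funext => n; rewrite /p horner_poly /series/= big_mkord.
by apply: eq_bigr.
Qed.

(** * Monotonicity of the even-index roots [u] and the odd-index roots [v] *)

Section Nested.
Context {R : realType} (alpha : R) (m : nat).
Hypothesis start : nested_start alpha m.

Let u k := r alpha (k.*2 + m).
Let v k := r alpha (k.*2 + m).+1.

Lemma small_window n x : (m <= n)%N -> 0 <= x <= r alpha m -> small alpha n x.
Proof. by case: start => a0 a1 _ _ sm mn x0; apply: small_le sm mn x0. Qed.

(** Induction: p_{n+2} <= p_n = 0 at [u k] yields a first root of p_{n+2} not beyond [u k]. The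
    bound by r_m is carried along to stay in the window where [small] holds. *)
Lemma r_even k :
  is_first_pos_root (horner (p alpha (k.*2 + m))) (u k) /\ u k <= r alpha m.
Proof.
have [a0 a1 ev F _] := start; elim: k => [|k [Fk uk]]; first by split.
have [u0 pu _] := Fk.
have pk : (p alpha (k.+1.*2 + m)).[u k] <= 0.
  rewrite -pu; apply: p_even_succ2_le => //; first exact: even_double_add.
  by apply: small_window; rewrite ?leq_addl ?(ltW u0).
by split; [exact: r_first_pos_root u0 pk|apply: le_trans uk; exact: r_le].
Qed.

Lemma r_even_gt0 k : 0 < u k. Proof. by have [[]] := r_even k. Qed.
Lemma r_even_root k : (p alpha (k.*2 + m)).[u k] = 0.
Proof. by have [[]] := r_even k. Qed.

Lemma r_even_noninc k : u k.+1 <= u k.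
Proof.
have [a0 a1 ev F _] := start; apply: r_le (r_even_gt0 k) _.
rewrite -(r_even_root k); apply: p_even_succ2_le => //; first exact: even_double_add.
apply: small_window; rewrite ?leq_addl ?(ltW (r_even_gt0 k))//.
by have [] := r_even k.
Qed.

Lemma p_odd_r_even k : (p alpha (k.*2 + m).+1).[u k] < 0.
Proof.
have [a0 a1 ev F _] := start; rewrite -(r_even_root k).
by apply: p_even_succ_lt (r_even_gt0 k) => //; exact: even_double_add.
Qed.

Lemma r_odd k : is_first_pos_root (horner (p alpha (k.*2 + m).+1)) (v k).
Proof. exact: r_first_pos_root (r_even_gt0 k) (ltW (p_odd_r_even k)). Qed.

Lemma r_odd_le_even k : v k <= u k.
Proof. exact: r_le (r_even_gt0 k) (ltW (p_odd_r_even k)). Qed.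

Lemma r_odd_gt0 k : 0 < v k. Proof. by have [] := r_odd k. Qed.
Lemma r_odd_root k : (p alpha (k.*2 + m).+1).[v k] = 0.
Proof. by have [] := r_odd k. Qed.

Lemma r_odd_le_start k : v k <= r alpha m.
Proof. by rewrite (le_trans (r_odd_le_even k))//; have [] := r_even k. Qed.

(** The odd comparison p_n <= p_{n+2} is evaluated at the later root, where the larger polynomial
    vanishes. *)
Lemma r_odd_nondec k : v k <= v k.+1.
Proof.
have [a0 a1 ev F _] := start; apply: r_le (r_odd_gt0 k.+1) _.
rewrite -(r_odd_root k.+1); apply: p_odd_succ2_ge => //.
  by rewrite /= even_double_add.
apply: small_window; first by rewrite ltnW// ltnS leq_addl.
by rewrite (ltW (r_odd_gt0 _)) r_odd_le_start.
Qed.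

Lemma r_even_homo : {homo u : k j / (k <= j)%N >-> j <= k}.
Proof. exact/nonincreasing_seqP/r_even_noninc. Qed.

Lemma r_odd_homo : {homo v : k j / (k <= j)%N >-> k <= j}.
Proof. exact/nondecreasing_seqP/r_odd_nondec. Qed.

Lemma r_odd_le_even2 k j : v k <= u j.
Proof.
apply: (@le_trans _ _ (v (maxn k j))); first by apply: r_odd_homo; rewrite leq_maxl.
apply: (le_trans (r_odd_le_even _)); apply: r_even_homo; exact: leq_maxr.
Qed.

Lemma r_between k n : (k.*2 + m <= n)%N -> v k <= r alpha n <= u k.
Proof.
move=> kn; have [j [nE|nE]] := @double_add_cover m n (leq_trans (leq_addl _ _) kn).
  have kj : (k <= j)%N by lia.
  by rewrite nE r_odd_le_even2; exact: r_even_homo.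
have kj : (k <= j)%N by lia.
by rewrite nE -[r _ _]/(v j) r_odd_le_even2 andbT; exact: r_odd_homo.
Qed.

(** On the window the even partial sums form a nonincreasing sequence, so their limit lies below
    each of them. *)
Lemma p_infty_le_even k x : 0 <= x <= r alpha m ->
  p_infty alpha x <= (p alpha (k.*2 + m)).[x].
Proof.
move=> xm; have [a0 a1 ev _ _] := start.
have cv := cvg_subseq_ge _ (fun k => k.*2 + m)%N _ (ltac:(lia))
  (cvg_p_infty _ x a0 a1).
rewrite -(cvg_lim _ cv)//; apply: (@nonincreasing_cvgn_ge _ _ _ _ k).
  apply/nonincreasing_seqP => j /=; apply: p_even_succ2_le => //.
    exact: even_double_add.
  by apply: small_window => //; exact: leq_addl.
by apply/cvg_ex; exists (p_infty alpha x).
Qed.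

Lemma p_infty_ge_odd k x : 0 <= x <= r alpha m ->
  (p alpha (k.*2 + m).+1).[x] <= p_infty alpha x.
Proof.
move=> xm; have [a0 a1 ev _ _] := start.
have cv := cvg_subseq_ge _ (fun k => (k.*2 + m).+1)%N _ (ltac:(lia))
  (cvg_p_infty _ x a0 a1).
rewrite -(cvg_lim _ cv)//; apply: (@nondecreasing_cvgn_le _ _ _ _ k).
  apply/nondecreasing_seqP => j /=; apply: p_odd_succ2_ge => //.
    by rewrite /= even_double_add.
  by apply: small_window => //; rewrite ltnW// ltnS leq_addl.
by apply/cvg_ex; exists (p_infty alpha x).
Qed.

(** * The common limit of the roots and the first root of [p_infty] *)

Hypothesis deriv_le0 : forall x : R, v 0 <= x <= r alpha m ->
  (p alpha m)^`().[x] <= 0.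

Lemma p_start_noninc x y : v 0 <= x -> x <= y -> y <= r alpha m ->
  (p alpha m).[y] <= (p alpha m).[x].
Proof.
move=> vx; rewrite le_eqVlt => /predU1P[->//|xy] ym.
have [c] := @polyrcf.poly_mvt _ _ _ (p alpha m) xy.
rewrite in_itv/= => /andP[xc cy] E; rewrite -subr_le0 E.
rewrite pmulr_lle0 ?subr_gt0//; apply: deriv_le0.
by rewrite (le_trans vx (ltW xc)) (le_trans (ltW cy)).
Qed.

Lemma p_even_increment_le k x y : 0 <= x -> x <= y -> y <= r alpha m ->
  (p alpha (k.+1.*2 + m)).[y] - (p alpha (k.+1.*2 + m)).[x] <=
  (p alpha (k.*2 + m)).[y] - (p alpha (k.*2 + m)).[x].
Proof.
move=> x0; rewrite le_eqVlt => /predU1P[->|xy] ym; first by rewrite !subrr.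
have [a0 a1 ev _ _] := start; have y0 : 0 <= y by rewrite ltW// (le_lt_trans x0).
apply/ltW; apply: p_even_increment_lt => //; [exact: even_double_add| |exact/andP].
by apply: small_window; rewrite ?leq_addl// y0.
Qed.

(** Passing from p_n to p_{n+2} can only lower the increment from x to y, so its sign is inherited
    from p_m. *)
Lemma p_even_noninc k x y : v 0 <= x -> x <= y -> y <= r alpha m ->
  (p alpha (k.*2 + m)).[y] <= (p alpha (k.*2 + m)).[x].
Proof.
move=> vx xy ym; elim: k => [|k IH]; first exact: p_start_noninc.
have x0 : 0 <= x by rewrite (le_trans _ vx)// ltW ?r_odd_gt0.
by have := p_even_increment_le k _ _ x0 xy ym; lra.
Qed.

Lemma p_odd_noninc k x y : v 0 <= x -> x <= y -> y <= r alpha m ->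
  (p alpha (k.*2 + m).+1).[y] <= (p alpha (k.*2 + m).+1).[x].
Proof.
move=> vx xy ym; have [a0 a1 ev _ _] := start.
have x0 : 0 <= x by rewrite (le_trans _ vx)// ltW ?r_odd_gt0.
rewrite !p_horner_succ -signr_odd /= even_double_add//= expr1 !mulN1r.
rewrite lerB ?p_even_noninc// ler_wpM2l ?(ltW (a_gt0 _ _ _))//.
by rewrite lerXn2r ?nnegrE// (le_trans x0).
Qed.

(** The form with arbitrary bounds x and y is meant for the limits of [v] and [u]. *)
Lemma r_gap x y : (forall k, v k <= x) -> (forall k, y <= u k) -> y <= x.
Proof.
move=> vx yu; rewrite leNgt; apply/negP => xy; have [a0 a1 ev _ _] := start.
have x0 : 0 <= x by rewrite (le_trans _ (vx 0%N))// ltW ?r_odd_gt0.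
have ym : y <= r alpha m := yu 0%N.
have y0 : 0 <= y by rewrite ltW// (le_lt_trans x0).
(* The derivative hypothesis makes p_m only nonincreasing; one step of two indices gives a strict
   drop from x to y. *)
pose g := p alpha m.+2.
have gxy : 0 < g.[x] - g.[y].
  have := p_even_increment_lt alpha m x y a0 a1 ev
    (small_window _ _ (leqnn m) (introT andP (conj y0 ym))) (introT andP (conj x0 xy)).
  by have := p_start_noninc _ _ (vx 0%N) (ltW xy) ym; rewrite -/g; lra.
suff : g.[x] - g.[y] <= 0 by rewrite leNgt gxy.
apply: (@le0_of_le_a_expr _ alpha (r alpha m) _ (fun k => (k.+1.*2 + m).+1)) => //.
  by move=> k; lia.
move=> k; set n := (k.+1.*2 + m)%N.
have v0 : v 0%N <= v k.+1 by apply: r_odd_homo.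
have vk0 := r_odd_gt0 k.+1.
have um : u k.+1 <= r alpha m by have [] := r_even k.+1.
have g1 : g.[x] <= g.[v k.+1].
  by apply: (p_even_noninc 1) => //; rewrite (le_trans (ltW xy)).
have g2 : g.[u k.+1] <= g.[y].
  by apply: (p_even_noninc 1) => //; rewrite (le_trans (vx 0%N))// ltW.
(* The drop of g over [[v k.+1], [u k.+1]], an interval containing [x, y], is at most that of p_n.
   The latter equals p_n at [v k.+1], since p_n vanishes at [u k.+1]. *)
have g3 : (p alpha n).[u k.+1] - (p alpha n).[v k.+1] <= g.[u k.+1] - g.[v k.+1].
  rewrite /n; elim: (k in (k.+1.*2 + m)%N) => [//|j IH].
  apply: le_trans IH; apply: p_even_increment_le => //; first exact: ltW.
  exact: r_odd_le_even.
have pv : (p alpha n).[v k.+1] = a alpha n.+1 * v k.+1 ^+ n.+1.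
  have := r_odd_root k.+1.
  rewrite p_horner_succ -signr_odd /= even_double_add//= expr1 !mulN1r.
  by move/eqP; rewrite subr_eq0 => /eqP.
apply: (@le_trans _ _ (a alpha n.+1 * v k.+1 ^+ n.+1)).
  by move: g3; rewrite r_even_root pv; lra.
rewrite ler_wpM2l ?(ltW (a_gt0 _ _ _))//.
by rewrite lerXn2r ?nnegrE ?(ltW vk0)// ?r_odd_le_start// (le_trans _ um)// ltW ?r_even_gt0.
Qed.

Lemma r_squeeze : exists s,
  [/\ forall k, v k <= s <= u k, u @ \oo --> s & v @ \oo --> s].
Proof.
have cu : cvgn u.
  apply: nonincreasing_is_cvgn; first exact: r_even_homo.
  by exists 0 => _ [k _ <-]; exact/ltW/r_even_gt0.
have cv : cvgn v.
  apply: nondecreasing_is_cvgn; first exact: r_odd_homo.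
  by exists (r alpha m) => _ [k _ <-]; exact: r_odd_le_start.
have vL k : v k <= limn v by apply: nondecreasing_cvgn_le => //; exact: r_odd_homo.
have Lu k : limn u <= u k by apply: nonincreasing_cvgn_ge => //; exact: r_even_homo.
have Lvu k : limn v <= u k.
  by apply: limr_le => //; apply: nearW => j; exact: r_odd_le_even2.
have LE : limn u = limn v.
  apply/eqP; rewrite eq_le r_gap//=.
  by apply: limr_ge => //; exact: nearW.
exists (limn v); split=> //; first by move=> k; rewrite vL Lvu.
by rewrite -LE.
Qed.

(** At s the even sums are nonnegative and the odd ones nonpositive; consecutive ones differ by
    a_{n+1} s^{n+1}, which tends to 0, and [p_infty] lies between them. *)
Lemma p_infty_first_pos_root s : (forall k, v k <= s <= u k) ->
  v @ \oo --> s -> is_first_pos_root (p_infty alpha) s.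
Proof.
move=> vsu vs; have [a0 a1 ev _ _] := start.
have vle k : v k <= s by have /andP[] := vsu k.
have sle k : s <= u k by have /andP[] := vsu k.
have s0 : 0 < s := lt_le_trans (r_odd_gt0 0) (vle 0%N).
have sm : 0 <= s <= r alpha m by rewrite (ltW s0) (sle 0%N).
have even_ge0 k : 0 <= (p alpha (k.*2 + m)).[s].
  by rewrite -(r_even_root k) p_even_noninc//; have [] := r_even k.
have odd_le0 k : (p alpha (k.*2 + m).+1).[s] <= 0.
  rewrite -(r_odd_root k) p_odd_noninc//; last exact: (sle 0%N).
  exact: r_odd_homo.
have gapE k : (p alpha (k.*2 + m)).[s] =
    (p alpha (k.*2 + m).+1).[s] + a alpha (k.*2 + m).+1 * s ^+ (k.*2 + m).+1.
  rewrite p_horner_succ -signr_odd /= even_double_add//= expr1 mulN1r.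
  by rewrite subrK.
have le0 c : (forall k, c <= a alpha (k.*2 + m).+1 * s ^+ (k.*2 + m).+1) -> c <= 0.
  by apply: (@le0_of_le_a_expr _ _ _ _ (fun k => (k.*2 + m).+1)) => // k; lia.
split=> //.
- apply/eqP; rewrite eq_le; apply/andP; split.
    apply: le0 => k; have := p_infty_le_even k s sm; have := odd_le0 k.
    by have := gapE k; lra.
  rewrite -oppr_le0; apply: le0 => k; have := p_infty_ge_odd k s sm.
  by have := even_ge0 k; have := gapE k; lra.
- move=> y y0 py; rewrite leNgt; apply/negP => ys.
  (* A root y < s would lie below some [v k]; but the odd sum is at most [p_infty] at y, hence
     nonpositive there, which forces [v k <= y]. *)
  have [k _ /(_ k (leqnn k)) /= yv] := @cvgr_gt _ _ _ _ _ _ vs _ ys.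
  have ym : 0 <= y <= r alpha m.
    by rewrite (ltW y0) (le_trans (ltW ys))//; have /andP[] := sm.
  have := p_infty_ge_odd k y ym; rewrite py => pk.
  by have := r_le _ _ _ y0 pk; rewrite leNgt -/(v k) yv.
Qed.

End Nested.

Theorem theorem3p6 (R : realType) (alpha : R) (n0 : nat)
    (alpha_gt0 : 0 < alpha) (alpha_le1 : alpha <= 1)
    (n0_gt0 : (0 < n0)%N) (n0_even : ~~ odd n0)
    (pn0_root : exists x : R, 0 < x /\ (p alpha n0).[x] = 0)
    (hr : r alpha n0 <=
          Gamma (2 * n0 + 6)%:R / Gamma ((2 * n0 + 5)%:R - alpha))
    (hr' : r alpha n0 <=
           (n0 + 1)%:R / (n0 + 2)%:R *
           (Gamma (2 * n0 + 6)%:R / Gamma ((2 * n0 + 5)%:R - alpha)))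
    (hderiv : forall x : R, r alpha (n0 + 1) <= x <= r alpha n0 ->
              (p alpha n0)^`().[x] <= 0) :
  [/\ forall n : nat, (n0 <= n)%N ->
        is_first_pos_root (horner (p alpha n)) (r alpha n),
      (fun n : nat => r alpha (n + 1) - r alpha n) @ \oo --> (0 : R)
    & exists s0 : R, is_first_pos_root (p_infty alpha) s0 /\
        forall eps : R, 0 < eps ->
          (exists nt : nat, (n0 <= nt)%N /\
             `|r alpha nt - r alpha (nt + 1)| < eps) /\
          (forall nt : nat, (n0 <= nt)%N ->
             `|r alpha nt - r alpha (nt + 1)| < eps ->
             `|s0 - r alpha nt| < eps)].
Proof.
have F : is_first_pos_root (horner (p alpha n0)) (r alpha n0).
  by have [x [x0 px]] := pn0_root; apply: r_first_pos_root x0 _; rewrite px.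
have start : nested_start alpha n0.
  split=> //; have [r0 _ _] := F; split; first exact: ltW.
  have q0 := ratio_gt0 alpha n0.+1 alpha_le1.
  (* The Gamma quotient in the hypotheses is 1 / q_{n0+1}, so [hr'] is the inequality in [small] at
     r_{n0}. *)
  have qE : ratio alpha n0.+1 =
      (Gamma (2 * n0 + 6)%:R / Gamma ((2 * n0 + 5)%:R - alpha))^-1.
    rewrite invf_div /ratio (_ : 2 * n0.+1 + 3 = 2 * n0 + 5)%N; last by lia.
    by rewrite (_ : 2 * n0.+1 + 4 = 2 * n0 + 6)%N//; lia.
  move: hr'; rewrite -[Gamma _ / _]invrK -qE ler_pdivlMr//.
  by rewrite addn1 addn2 ler_pdivlMr ?ltr0n// mulrC [r _ _ * _]mulrC.
have hd x : r alpha (0.*2 + n0).+1 <= x <= r alpha n0 -> (p alpha n0)^`().[x] <= 0.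
  by have := hderiv x; rewrite addn1.
have [s [vsu us vs]] := r_squeeze _ _ start hd.
have cv : (fun n => r alpha (n + 1) - r alpha n) @ \oo --> (0 : R).
  apply/cvgrPdist_lt => eps eps0.
  have uv : (fun k => r alpha (k.*2 + n0) - r alpha (k.*2 + n0).+1) @ \oo --> (0 : R).
    by rewrite -(subrr s); exact: cvgB.
  have [k _ /(_ k (leqnn k)) /= ke] := @cvgr_lt _ _ _ _ _ _ uv _ eps0.
  exists (k.*2 + n0)%N => // n /= kn.
  (* All roots of index at least 2k + n0 lie in [v_k, u_k], an interval of length below eps. *)
  have /andP[n1 n2] := r_between _ _ start k n kn.
  have /andP[n3 n4] := r_between _ _ start k n.+1 (leqW kn).
  by rewrite addn1 sub0r normrN ltr_norml; apply/andP; split; lra.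
split=> //.
  move=> n /double_add_cover[k [->|->]]; first by have [] := r_even _ _ start k.
  exact: r_odd.
exists s; split; first exact: (p_infty_first_pos_root _ _ start hd).
move=> eps eps0; split.
  have /cvgrPdist_lt/(_ _ eps0)[N _ NE] := cv.
  exists (maxn N n0); split; first exact: leq_maxr.
  by have := NE _ (leq_maxl N n0); rewrite /= sub0r opprB.
(* Two consecutive roots enclose s whatever the parity of n, so s is no farther from r_n than
   r_{n+1} is. *)
move=> n n0n; apply: le_lt_trans; rewrite addn1.
have [k [->|->]] := double_add_cover _ _ n0n; have /andP[vk uk] := vsu k.
  rewrite distrC ger0_norm ?subr_ge0// ger0_norm ?subr_ge0 ?(le_trans vk)//.
  by rewrite lerB.
(* For odd n the next root belongs to the even family with index k+1. *)
have /andP[_ uk1] := vsu k.+1.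
rewrite -[(k.*2 + n0).+2]/(k.+1.*2 + n0)%N [leRHS]distrC.
rewrite ger0_norm ?subr_ge0// ger0_norm ?subr_ge0 ?(le_trans vk)//.
by rewrite lerB.
Qed.
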